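(* Let $\{\alpha_k\}_{k\ge0}$ be complex numbers with $|\alpha_k|<1$, $\rho_k=\sqrt{1-|\alpha_k|^2}$, let $\{s_k\}_{k\ge1}$ be a sequence in $\{0,1\}$, and let $\mathcal{S}$ be the associated snake-shaped matrix factorization. Then, for $i,j\ge0$, the $(i,j)$ entry of $\mathcal{S}$ is obtained from the following graphical recipe. (E1) Draw the snake underlying $\mathcal{S}$. (E2) Place a right-pointing arrow on the left of the snake at height $i$. (E3) Place a left-pointing arrow on the right of the snake at height $j$. (E4) Draw the path on the snake induced between these two arrows. (E5) If the path moves monotonically from left to right, then the $(i,j)$ entry of $\mathcal{S}$ equals a product of entries of the encountered $2\times2$ matrices $\tilde G_{k,k+1}$ on the path, as specified in (E5'). (E6) If the path does not move monotonically from left to right, then the $(i,j)$ entry of $\mathcal{S}$ equals zero. (E5') Under the assumptions of (E5), let $G_{r,r+1}$ and $G_{t,t+1}$ denote the two outermost line segments of the path (so $r\in\{i-1,i\}$ and $t\in\{j-1,j\}$, the precise values depending on the shape of the snake), and let $\mathcal{K}$ be the set of indices $k$ of the innermost segments $G_{k,k+1}$ on the path, i.e. $\mathcal{K}=\{r+1,\dots,t-1\}$ if $r<t$ and $\mathcal{K}=\{t+1,\dots,r-1\}$ if $r>t$ (with $\mathcal{K}=\emptyset$ when $|r-t|=1$). Then the $(i,j)$ entry of $\mathcal{S}$ equals $$x_r\cdot\Big(\prod_{k\in\mathcal{K}}\rho_k\Big)\cdot y_t,$$ where $x_r\in\{\overline{\alpha_r},\rho_r,-\alpha_r\}$ and $y_t\in\{\overline{\alpha_t},\rho_t,-\alpha_t\}$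 are the entries of $\tilde G_{r,r+1}$ and $\tilde G_{t,t+1}$ found by the following rule: imagine being in the line segment of the current factor; the row index of the entry (top or bottom row) is given by whether one leaves the segment through its topmost or bottommost index when moving leftwards on the path, and the column index (first or second column) by whether one leaves it through its topmost or bottommost index when moving rightwards on the path. Explicitly, $x_r$ is the $(i-r,b)$ entry of $\tilde G_{r,r+1}$ and $y_t$ is the $(1-b,j-t)$ entry of $\tilde G_{t,t+1}$, where $b=0$ if $r>t$ and $b=1$ if $r<t$.
   Context: All matrix rows and columns (including those of $2\times2$ matrices) are indexed from $0$. Put $$\tilde G_{k,k+1}=\begin{bmatrix}\overline{\alpha_k}&\rho_k\\ \rho_k&-\alpha_k\end{bmatrix},$$ and let $G_{k,k+1}$ be the infinite matrix equal to the identity except that its block in rows and columns $\{k,k+1\}$ is $\tilde G_{k,k+1}$. Define $\mathcal{S}^{(0)}=G_{0,1}$ and, for $k\ge1$, $\mathcal{S}^{(k)}=\mathcal{S}^{(k-1)}G_{k,k+1}$ if $s_k=0$ and $\mathcal{S}^{(k)}=G_{k,k+1}\mathcal{S}^{(k-1)}$ if $s_k=1$. The snake-shaped matrix factorization $\mathcal{S}=\mathcal{S}^{(\infty)}$ is the infinite matrix whose principal $n\times n$ submatrix (rows and columns $0,\dots,n-1$) coincides with that of $\mathcal{S}^{(n-1)}$ for every $n\ge1$. The snake: the factor $G_{k,k+1}$ is drawn as a vertical line segment from height $k$ to height $k+1$ (heights increase downwards, so $k$ is the topmost and $k+1$ the bottommost index of the segment). Starting from the segment $G_{0,1}$, the segment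 $G_{k,k+1}$ is added at the bottom right of $G_{k-1,k}$ if $s_k=0$ and at the bottom left of $G_{k-1,k}$ if $s_k=1$. The path: the arrow from the left at height $i$ enters the snake in the first segment it meets at that height (the leftmost of the segments $G_{i-1,i}$, $G_{i,i+1}$), the arrow from the right at height $j$ enters the snake in the rightmost of the segments $G_{j-1,j}$, $G_{j,j+1}$ (for height $0$ only $G_{0,1}$ is available), and the path runs along the consecutive segments of the snake from the first of these segments to the second. At its two ends the path is left through the arrows, at heights $i$ and $j$. *)

(* Defs.v *)
From HB Require Import structures.
From mathcomp Require Import all_boot all_order all_algebra.
From mathcomp Require Import complex.
From mathcomp Require Import classical_sets fsbigop reals.

Set Implicit Arguments.
Unset Strict Implicit.
Unset Printing Implicit Defensive.

Import Order.TTheory GRing.Theory Num.Theory.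

Local Open Scope classical_set_scope.
Local Open Scope ring_scope.

Section Matrices.
Variable R : realType.
Implicit Types (alpha : nat -> R[i]) (s : nat -> bool).

Definition rho alpha (k : nat) : R[i] := sqrtC (1 - `|alpha k| ^+ 2).

Definition Gtilde alpha (k : nat) : 'M[R[i]]_2 :=
  \matrix_(a < 2, b < 2)
    nth 0 (nth [::] [:: [:: (alpha k)^* ; rho alpha k];
                        [:: rho alpha k ; - alpha k]] a) b.

(* Entries of [Gtilde] with row and column given as naturals; only meaningful
   for [a] and [b] in {0, 1} ([inord] sends every other value to 0). *)
Definition Gentry alpha (k a b : nat) : R[i] :=
  Gtilde alpha k (inord a) (inord b).

Definition infmx := nat -> nat -> R[i].

(* The sum is the finite-support sum of [fsbigop] (which is 0 on infinite
   supports). All matrices multiplied below have finitely many nonzero entries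
   in each row and column, so this is the usual product. *)
Definition infmx_mul (A B : infmx) : infmx :=
  fun i j => \sum_(l \in [set: nat]) A i l * B l j.

Definition Gmx alpha (k : nat) : infmx := fun i j =>
  if (k <= i <= k.+1)%N && (k <= j <= k.+1)%N
  then Gentry alpha k (i - k) (j - k)
  else (i == j)%:R.

(* [s k] encodes s_k, [false] for 0 and [true] for 1; [s 0] is unused. *)
Fixpoint snake_part alpha s (k : nat) : infmx :=
  if k is k'.+1 then
    if s k then infmx_mul (Gmx alpha k) (snake_part alpha s k')
    else infmx_mul (snake_part alpha s k') (Gmx alpha k)
  else Gmx alpha 0.

Definition principal_submx (n : nat) (A : infmx) : 'M[R[i]]_n :=
  \matrix_(i < n, j < n) A i j.

Definition is_snake_mx alpha s (S : infmx) : Prop :=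
  forall n : nat, (1 <= n)%N ->
    principal_submx n S = principal_submx n (snake_part alpha s n.-1).

End Matrices.

Section Drawing.
Variable s : nat -> bool.

(* Horizontal position at which the segment G_{k,k+1} is drawn. *)
Fixpoint hpos (k : nat) : int :=
  if k is k'.+1 then hpos k' + (if s k then -1 else 1) else 0.

(* Index k of the first segment G_{k,k+1} met at height [i] from the left,
   resp. at height [j] from the right. *)
Definition enter_left (i : nat) : nat :=
  if i is i'.+1 then if hpos i' < hpos i then i' else i else 0%N.

Definition enter_right (j : nat) : nat :=
  if j is j'.+1 then if hpos j' < hpos j then j else j' else 0%N.

(* The indices of the consecutive segments from G_{r,r+1} to G_{t,t+1}. *)
Definition snake_path (r t : nat) : seq nat :=
  if (r <= t)%N then iota r (t - r).+1 else rev (iota t (r - t).+1).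

Definition induced_path (i j : nat) : seq nat :=
  snake_path (enter_left i) (enter_right j).

Definition moves_left_to_right (p : seq nat) : bool :=
  sorted (fun k l => hpos k < hpos l) p.

(* Heights at which the path induced by the arrows at heights [i] and [j]
   leaves its segment G_{k,k+1} when moving leftwards, resp. rightwards. At the
   two ends of the path these are the heights of the arrows; elsewhere they are
   the endpoint shared with the neighbouring segment: on a path going down
   (r < t), the top k on the left and the bottom k+1 on the right, and
   conversely on a path going up. *)
Definition exit_left (i j k : nat) : nat :=
  if k == enter_left i then i
  else if (enter_left i < enter_right j)%N then k else k.+1.

Definition exit_right (i j k : nat) : nat :=
  if k == enter_right j then j
  else if (enter_left i < enter_right j)%N then k.+1 else k.

End Drawing.

Section Existence.
Variable R : realType.
Implicit Types (alpha : nat -> R[i]) (s : nat -> bool).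

Lemma Gmx_id alpha k i j : (i < k)%N || (j < k)%N ->
  Gmx alpha k i j = (i == j)%:R.
Proof.
rewrite /Gmx => h; case: ifP => // /andP[/andP[hi _] /andP[hj _]].
by case/orP: h; rewrite ltnNge ?hi ?hj.
Qed.

Lemma snake_part_stable alpha s k m i j : (i <= k)%N -> (j <= k)%N ->
  snake_part alpha s (m + k) i j = snake_part alpha s k i j.
Proof.
move=> ik jk; elim: m => [//|m <-]; rewrite addSn /=.
have lt x : (x <= k)%N -> (x < (m + k).+1)%N.
  by move=> xk; rewrite ltnS (leq_trans xk) ?leq_addl.
case: ifP => _; rewrite /infmx_mul.
- rewrite (fsbigE [:: i]) //= => [|l _].
    by rewrite big_cons big_nil mem_set //= addr0 Gmx_id ?lt // eqxx mul1r.
  by rewrite inE eq_sym => /negPf il; rewrite Gmx_id ?il ?mul0r // lt.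
- rewrite (fsbigE [:: j]) //= => [|l _].
    by rewrite big_cons big_nil mem_set //= addr0 Gmx_id ?lt ?orbT // eqxx mulr1.
  by rewrite inE => /negPf lj; rewrite Gmx_id ?lj ?mulr0 // (lt j) ?orbT.
Qed.

(* The infinite matrix specified by [is_snake_mx] exists; it is clearly
   unique. *)
Lemma is_snake_mx_exists alpha s : exists S, is_snake_mx alpha s S.
Proof.
exists (fun i j => snake_part alpha s (maxn i j) i j) => -[//|n] _.
apply/matrixP => i j; rewrite !mxE /=.
have mn : (maxn i j <= n)%N by rewrite geq_max !leq_ord.
have := snake_part_stable alpha s (n - maxn i j) (leq_maxl i j) (leq_maxr i j).
by rewrite subnK.
Qed.

End Existence.

(* Main.v *)
(* The entries of every finite product [snake_part alpha s n] at heights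
    [i, j <= n.+1] follow the recipe, provided that the arrows at height [n.+1]
    enter the last segment [n]. This is proved by induction on [n]. If
    G_{n+1,n+2} is multiplied on the right, only the columns n+1 and n+2 change:
    for [i <= n.+1] they become column n+1 of the old product times the top row
    of G~_{n+1,n+2}, and correspondingly a path that ended in segment [n]
    through its bottom right is extended by one segment; its former last factor
    turns from an entry in y-position into the inner factor rho_n.
    Since every G_{k,k+1} is symmetric, transposing the snake amounts to negating
    [s], which reduces multiplication on the left to the previous case. *)

Require Import Defs.
From HB Require Import structures.
From mathcomp Require Import all_boot all_order all_algebra.
From mathcomp Require Import complex.
From mathcomp Require Import classical_sets fsbigop reals.
From mathcomp Require Import zify.

Set Implicit Arguments.
Unset Strict Implicit.
Unset Printing Implicit Defensive.

Import Order.TTheory GRing.Theory Num.Theory.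

Local Open Scope ring_scope.

(** * Geometry of the snake: entry segments and monotone paths *)

Section SnakeGeometry.
Implicit Types (s : nat -> bool) (i j k n r t : nat).

Definition flip s : nat -> bool := fun k => ~~ s k.

(** Detaches the two outermost segments of a path from the inner ones, which only contribute factors
    [rho]. *)
Lemma iota_ends m n : (m < n)%N ->
  iota m (n - m).+1 = m :: rcons (index_iota m.+1 n) n.
Proof.
move=> lt_mn; rewrite /index_iota (_ : (n - m).+1 = 1 + (n - m.+1) + 1)%N; last lia.
by rewrite !iotaD /= cats1 addn1; congr (_ :: rcons _ _); lia.
Qed.

Lemma hpos_lt_succ s k : (hpos s k < hpos s k.+1) = ~~ s k.+1.
Proof. by rewrite /= ltrDl; case: (s k.+1). Qed.

Lemma hpos_succ_lt s k : (hpos s k.+1 < hpos s k) = s k.+1.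
Proof. by rewrite /= gtrDl; case: (s k.+1). Qed.

Lemma enter_leftS s i : enter_left s i.+1 = if s i.+1 then i.+1 else i.
Proof. by rewrite /enter_left hpos_lt_succ; case: (s i.+1). Qed.

Lemma enter_rightS s j : enter_right s j.+1 = if s j.+1 then j else j.+1.
Proof. by rewrite /enter_right hpos_lt_succ; case: (s j.+1). Qed.

Lemma enter_left_bounds s i : (enter_left s i <= i <= (enter_left s i).+1)%N.
Proof. by case: i => // i; rewrite enter_leftS; case: ifP; lia. Qed.

Lemma enter_right_bounds s j : (enter_right s j <= j <= (enter_right s j).+1)%N.
Proof. by case: j => // j; rewrite enter_rightS; case: ifP; lia. Qed.

Lemma enter_left_flip s i : enter_left (flip s) i = enter_right s i.
Proof.
by case: i => // i; rewrite enter_leftS enter_rightS /flip; case: (s i.+1).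
Qed.

Lemma enter_right_flip s j : enter_right (flip s) j = enter_left s j.
Proof.
by case: j => // j; rewrite enter_leftS enter_rightS /flip; case: (s j.+1).
Qed.

Lemma moves_down s r t : (r <= t)%N ->
  moves_left_to_right s (snake_path r t) = all (flip s) (iota r.+1 (t - r)).
Proof.
rewrite /moves_left_to_right /snake_path => -> /=; move: (t - r)%N => m.
by elim: m r => //= m IHm r; rewrite IHm hpos_lt_succ.
Qed.

Lemma moves_up s r t : (t <= r)%N ->
  moves_left_to_right s (snake_path r t) = all s (iota t.+1 (r - t)).
Proof.
rewrite leq_eqVlt => /predU1P[->|lt_tr]; first by rewrite moves_down // subnn.
rewrite /moves_left_to_right /snake_path leqNgt lt_tr /= rev_sorted.
move: (r - t)%N => m; elim: m t {lt_tr} => //= m IHm t.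
by rewrite IHm hpos_succ_lt.
Qed.

Lemma moves_flip s r t :
  moves_left_to_right (flip s) (snake_path t r) =
  moves_left_to_right s (snake_path r t).
Proof.
case: (leqP r t) => [le_rt | /ltnW le_tr].
  by rewrite moves_up // moves_down.
by rewrite moves_down // moves_up //; apply: eq_all => k; rewrite /flip negbK.
Qed.

Lemma moves_downS s r t : (r <= t)%N ->
  moves_left_to_right s (snake_path r t.+1) =
  moves_left_to_right s (snake_path r t) && ~~ s t.+1.
Proof.
move=> le_rt; rewrite !moves_down ?leqW // subSn // -(addn1 (t - r)) iotaD all_cat /=.
by rewrite andbT addSn subnKC.
Qed.

(** Segment [r.+1] hangs to the right of segment [r], so the very first step upwards goes left. This
    is the source of the zeros in a new bottom row. *)
Lemma moves_upSN s r t : (t <= r)%N -> ~~ s r.+1 ->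
  moves_left_to_right s (snake_path r.+1 t) = false.
Proof.
move=> le_tr /negPf sN; rewrite moves_up ?leqW // subSn // -(addn1 (r - t)) iotaD all_cat.
by rewrite /= addSn subnKC // sN andbF.
Qed.

(* In the finite snake with segments [0, ..., n], both arrows at the bottom
   height [n.+1] enter the last segment. *)
Definition part_enter_left s n i := if (i <= n)%N then enter_left s i else n.

Definition part_enter_right s n j := if (j <= n)%N then enter_right s j else n.

Lemma part_enter_left_le s n i : (part_enter_left s n i <= n)%N.
Proof.
by rewrite /part_enter_left; case: ifP; have := enter_left_bounds s i; lia.
Qed.

Lemma part_enter_right_le s n j : (part_enter_right s n j <= n)%N.
Proof.
by rewrite /part_enter_right; case: ifP; have := enter_right_bounds s j; lia.
Qed.

End SnakeGeometry.

(** * Entries of the products, and their agreement with the recipe *)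

Section SnakeEntries.
Variables (R : realType) (alpha : nat -> R[i]).
Implicit Types (A B : infmx R) (s : nat -> bool) (i j k n r t : nat).

Lemma Gentry_sym k a b : Gentry alpha k a b = Gentry alpha k b a.
Proof.
rewrite /Gentry !mxE.
by case: (inord a) => -[|[|//]] ?; case: (inord b) => -[|[|//]] ?.
Qed.

Lemma Gentry01 k : Gentry alpha k 0 1 = rho alpha k.
Proof. by rewrite /Gentry mxE !inordK. Qed.

Lemma Gmx_sym k i j : Gmx alpha k i j = Gmx alpha k j i.
Proof. by rewrite /Gmx andbC Gentry_sym eq_sym. Qed.

Lemma infmx_mul_tr A B i j :
  infmx_mul A B i j = infmx_mul (fun x y => B y x) (fun x y => A y x) j i.
Proof. by apply: eq_fsbigr => l _; rewrite mulrC. Qed.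

Lemma eq_infmx_mul A A' B B' : A =2 A' -> B =2 B' ->
  infmx_mul A B =2 infmx_mul A' B'.
Proof. by move=> eqA eqB i j; apply: eq_fsbigr => l _; rewrite eqA eqB. Qed.

Lemma snake_part_flip s n i j :
  snake_part alpha (flip s) n i j = snake_part alpha s n j i.
Proof.
elim: n i j => [|n IHn] i j; first exact: Gmx_sym.
rewrite /= {1}/flip; case: (s n.+1) => /=; rewrite infmx_mul_tr.
  by apply: eq_infmx_mul => x y; [exact: Gmx_sym | exact: IHn].
by apply: eq_infmx_mul => x y; [exact: IHn | exact: Gmx_sym].
Qed.

Lemma infmx_mul_Gmx A k i j :
  infmx_mul A (Gmx alpha k) i j =
  if (k <= j <= k.+1)%N
  then A i k * Gentry alpha k 0 (j - k) + A i k.+1 * Gentry alpha k 1 (j - k)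
  else A i j.
Proof.
rewrite /infmx_mul /Gmx; case: ifP => jk.
  rewrite (fsbigE [:: k; k.+1]) //=.
  - rewrite !big_cons big_nil !mem_set // !leqnn !leqnSn subnn subSnn /=.
    by rewrite addr0.
  - by rewrite inE ltn_eqF.
  - move=> l _; rewrite !inE andbT => lk.
    have /negPf-> : ~~ (k <= l <= k.+1)%N by lia.
    by have /negPf-> : l != j by [lia]; rewrite mulr0.
rewrite (fsbigE [:: j]) //= => [|l _].
  by rewrite big_cons big_nil mem_set // andbF eqxx mulr1 addr0.
by rewrite inE andbF => /negPf->; rewrite mulr0.
Qed.

Lemma snake_part_id s n i j : (n.+1 < i)%N || (n.+1 < j)%N ->
  snake_part alpha s n i j = (i == j)%:R.
Proof.
elim: n s i j => [|n IHn] s i j; first by rewrite /= /Gmx; case: ifP => //; lia.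
wlog sN : s i j / s n.+1 = false => [wlogsN ij|ij].
  case sn: (s n.+1); last exact: wlogsN.
  by rewrite -snake_part_flip wlogsN 1?orbC // 1?eq_sym // /flip sn.
rewrite /= sN infmx_mul_Gmx; case: ifP => jn; last by rewrite IHn //; lia.
(* Here [j] is at most [n.+2], so [i] exceeds [n.+2] and every entry involved is an off-diagonal
   zero. *)
rewrite !IHn; [|lia..].
have /negPf-> : i != n.+1 by lia.
have /negPf-> : i != n.+2 by lia.
by have /negPf-> : i != j by [lia]; rewrite !mul0r addr0.
Qed.

(** The comparisons, read as numbers, encode [b] and [1 - b]. A path with a single segment needs its
    own case: both exits are then arrows, and only one entry occurs. *)
Definition path_weight r t i j : R[i] :=
  if r == t then Gentry alpha r (i - r) (j - r)
  else Gentry alpha r (i - r) (r < t)%N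
       * (\prod_((minn r t).+1 <= k < maxn r t) rho alpha k)
       * Gentry alpha t (t < r)%N (j - t).

Definition recipe_entry s r t i j : R[i] :=
  if moves_left_to_right s (snake_path r t) then path_weight r t i j else 0.

Lemma path_weight_sym r t i j : path_weight t r j i = path_weight r t i j.
Proof.
rewrite /path_weight eq_sym; case: eqP => [->|_]; first exact: Gentry_sym.
rewrite minnC maxnC Gentry_sym [in RHS]Gentry_sym mulrC mulrA.
by rewrite [in RHS]mulrAC -!mulrA mulrC -!mulrA.
Qed.

(** An old path leaving through height [n.+1] selects column 1 of segment [n]. If [r = n], this is
    already the outer entry with [b = 1]; otherwise it is [rho alpha n], which joins the inner
    product. *)
Lemma path_weightS r n i j : (r <= n)%N ->
  path_weight r n.+1 i j =
  path_weight r n i n.+1 * Gentry alpha n.+1 0 (j - n.+1).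
Proof.
move=> le_rn; rewrite /path_weight ltn_eqF ?ltnS // le_rn.
rewrite (minn_idPl (leqW le_rn)) (maxn_idPr (leqW le_rn)) ltnNge leqW //=.
case: eqP => [->|/eqP ne_rn]; first by rewrite big_geq // mulr1 subSnn.
have lt_rn : (r < n)%N by rewrite ltn_neqAle ne_rn.
rewrite lt_rn ltnNge le_rn /= (minn_idPl le_rn) (maxn_idPr le_rn).
by rewrite big_nat_recr //= subSnn Gentry01 !mulrA.
Qed.

Lemma recipe_entry_flip s r t i j :
  recipe_entry (flip s) t r j i = recipe_entry s r t i j.
Proof. by rewrite /recipe_entry moves_flip path_weight_sym. Qed.

Lemma part_enter_left_flip s n i :
  part_enter_left (flip s) n i = part_enter_right s n i.
Proof. by rewrite /part_enter_left enter_left_flip. Qed.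

Lemma part_enter_right_flip s n j :
  part_enter_right (flip s) n j = part_enter_left s n j.
Proof. by rewrite /part_enter_right enter_right_flip. Qed.

Lemma snake_partE s n i j : (i <= n.+1)%N -> (j <= n.+1)%N ->
  snake_part alpha s n i j =
  recipe_entry s (part_enter_left s n i) (part_enter_right s n j) i j.
Proof.
elim: n s i j => [|n IHn] s i j le_i le_j.
  have -> : part_enter_left s 0 i = 0%N by have := part_enter_left_le s 0 i; lia.
  have -> : part_enter_right s 0 j = 0%N by have := part_enter_right_le s 0 j; lia.
  by rewrite /recipe_entry moves_down //= /Gmx le_i le_j.
wlog sN : s i j le_i le_j / s n.+1 = false => [wlogsN|].
  case sn: (s n.+1); last exact: wlogsN.
  rewrite -snake_part_flip wlogsN ?/flip ?sn // part_enter_left_flip.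
  by rewrite part_enter_right_flip recipe_entry_flip.
have left_last : part_enter_left s n.+1 n.+2 = n.+1.
  by rewrite /part_enter_left ltnn.
(* The new segment lies to the right of segment [n]: at height [n.+1] the left arrow still meets
   segment [n], while the right arrow meets the new one. *)
have left_old x : (x <= n.+1)%N ->
    part_enter_left s n.+1 x = part_enter_left s n x.
  rewrite /part_enter_left => le_x; rewrite le_x; case: leqP => // lt_nx.
  by have -> : x = n.+1 by [lia]; rewrite enter_leftS sN.
have right_new : (n.+1 <= j)%N -> part_enter_right s n.+1 j = n.+1.
  rewrite /part_enter_right => le_nj; case: leqP => // le_jn.
  by have -> : j = n.+1 by [lia]; rewrite enter_rightS sN.
have right_old : (j <= n)%N ->
    part_enter_right s n.+1 j = part_enter_right s n j.
  by rewrite /part_enter_right => le_jn; rewrite le_jn leqW.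
rewrite /= sN infmx_mul_Gmx le_j andbT; case: (ltnP n j) => [lt_nj|le_jn].
  (* Column [n.+2] of the old product is that of the identity, so exactly one of the two terms
     survives, depending on whether [i = n.+2]. *)
  rewrite right_new // [snake_part alpha s n i n.+2]snake_part_id ?leqnn ?orbT //.
  case: (ltngtP i n.+2) le_i => // [lt_i|->] _.
    rewrite mul0r addr0 left_old // IHn //.
    have -> : part_enter_right s n n.+1 = n by rewrite /part_enter_right ltnn.
    have le_r := part_enter_left_le s n i.
    rewrite /recipe_entry moves_downS // sN andbT.
    by case: ifP => _; rewrite ?mul0r // path_weightS.
  rewrite snake_part_id ?leqnn // gtn_eqF // mul0r add0r mul1r left_last.
  rewrite /recipe_entry moves_down // subnn /=.
  by rewrite /path_weight eqxx subSnn.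
rewrite right_old //; case: (ltngtP i n.+2) le_i => // [lt_i|->] _.
  by rewrite left_old // IHn // leqW.
(* The remaining entry, in row [n.+2] and a column at most [n], is an off-diagonal zero; its path
   starts upwards from the new segment, hence to the left. *)
rewrite left_last snake_part_id ?leqnn // gtn_eqF ?ltnS ?leqW //.
by rewrite /recipe_entry moves_upSN ?sN // part_enter_right_le.
Qed.

(** The finite snake ending in segment [maxn i j] has its bottom strictly below both arrows, so its
    truncated entry rule is the true one. *)
Lemma snake_mxE s (S : infmx R) : is_snake_mx alpha s S ->
  forall i j, S i j = recipe_entry s (enter_left s i) (enter_right s j) i j.
Proof.
move=> hS i j; pose n := maxn i j.
have lt_i : (i < n.+1)%N by rewrite ltnS leq_maxl.
have lt_j : (j < n.+1)%N by rewrite ltnS leq_maxr.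
have /matrixP/(_ (Ordinal lt_i) (Ordinal lt_j)) := hS n.+1 isT.
rewrite !mxE /= => ->; rewrite snake_partE 1?ltnW //.
by rewrite /part_enter_left /part_enter_right -ltnS lt_i -ltnS lt_j.
Qed.

(** An inner segment is left through opposite ends in the two directions, so the exit rule selects
    an off-diagonal entry, which is [rho] by symmetry whichever way the path runs. *)
Lemma path_weight_prod s i j :
  \prod_(k <- induced_path s i j)
    Gentry alpha k (exit_left s i j k - k) (exit_right s i j k - k) =
  path_weight (enter_left s i) (enter_right s j) i j.
Proof.
rewrite /induced_path /exit_left /exit_right /path_weight /snake_path.
move: (enter_left s i) (enter_right s j) => r t.
case: (ltngtP r t) => [lt_rt|lt_tr|->].
- rewrite iota_ends // big_cons big_rcons /= !eqxx ltn_eqF // gtn_eqF //.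
  rewrite subSnn subnn -mulrA; congr (_ * (_ * _)).
  apply: eq_big_nat => k /andP[lt_rk lt_kt].
  by rewrite gtn_eqF // ltn_eqF // subnn subSnn Gentry01.
- rewrite big_rev iota_ends // big_cons big_rcons /= !eqxx ltn_eqF // gtn_eqF //.
  rewrite subSnn subnn mulrC; congr (_ * _); rewrite mulrC; congr (_ * _).
  apply: eq_big_nat => k /andP[lt_tk lt_kr].
  by rewrite ltn_eqF // gtn_eqF // subnn subSnn Gentry_sym Gentry01.
- by rewrite subnn /= big_cons big_nil !eqxx mulr1.
Qed.

End SnakeEntries.

Theorem mainTheorem2 (R : realType) (alpha : nat -> R[i]) (s : nat -> bool)
    (S : infmx R)
    (halpha : forall k : nat, `|alpha k| < 1)
    (hS : is_snake_mx alpha s S)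
    (i j : nat) :
  let r := enter_left s i in
  let t := enter_right s j in
  let path := induced_path s i j in
  [/\ (r <= i <= r.+1)%N /\ (t <= j <= t.+1)%N,
      (* product of the entries selected on the path by the exit rule *)
      moves_left_to_right s path ->
        S i j = \prod_(k <- path)
                  Gentry alpha k (exit_left s i j k - k) (exit_right s i j k - k),
      (* explicit form of that product when the two outermost segments differ *)
      moves_left_to_right s path -> r <> t ->
        let b : nat := if (r < t)%N then 1%N else 0%N in
        S i j = Gentry alpha r (i - r) b
                * (\prod_((minn r t).+1 <= k < maxn r t) rho alpha k)
                * Gentry alpha t (1 - b) (j - t)
    & ~~ moves_left_to_right s path -> S i j = 0].
Proof.
move=> r t path; rewrite (snake_mxE hS) /recipe_entry -/(induced_path s i j).
rewrite -/path -/r -/t; split.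
- by split; [exact: enter_left_bounds | exact: enter_right_bounds].
- by move=> ->; rewrite path_weight_prod.
- move=> -> /eqP/negPf ne_rt; rewrite /path_weight ne_rt.
  (* As [r] and [t] differ, [1 - b] is the truth value of [t < r]. *)
  by case: (ltngtP r t) ne_rt.
- by move=> /negPf->.
Qed.
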